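(* Let $q,\beta>0$, $0<\alpha<1$, $r\in\mathbb{N}$, and let $k_1\le k_2\le\dots\le k_r$ be natural numbers with $k_p^{1-\alpha}>2$ for $p=1,\dots,r$. Let $f\in C_B(\mathbb{R})$. Let $M\in\mathbb{N}$ and weights $w_1,\dots,w_M\ge0$ with $\sum_{j=1}^M w_j=1$ be given (used to define $\overline{B}_n$). Then: (i) $$\|B_{k_r}(B_{k_{r-1}}(\cdots B_{k_2}(B_{k_1}f)))-f\|_\infty\le\sum_{p=1}^r\|B_{k_p}f-f\|_\infty\le\sum_{p=1}^r\left[\omega\left(f,\frac1{k_p^\alpha}\right)+\frac{2\left(q+\frac1q\right)\|f\|_\infty}{e^{\beta(k_p^{1-\alpha}-1)}}\right]\le r\left[\omega\left(f,\frac1{k_1^\alpha}\right)+\frac{2\left(q+\frac1q\right)\|f\|_\infty}{e^{\beta(k_1^{1-\alpha}-1)}}\right],$$ (ii) $$\|B^*_{k_r}(B^*_{k_{r-1}}(\cdots B^*_{k_2}(B^*_{k_1}f)))-f\|_\infty\le\sum_{p=1}^r\|B^*_{k_p}f-f\|_\infty\le\sum_{p=1}^r\left[\omega\left(f,\frac1{k_p}+\frac1{k_p^\alpha}\right)+\frac{2\left(q+\frac1q\right)\|f\|_\infty}{e^{\beta(k_p^{1-\alpha}-1)}}\right]\le r\left[\omega\left(f,\frac1{k_1}+\frac1{k_1^\alpha}\right)+\frac{2\left(q+\frac1q\right)\|f\|_\infty}{e^{\beta(k_1^{1-\alpha}-1)}}\right],$$ (iii) $$\|\overline{B}_{k_r}(\overline{B}_{k_{r-1}}(\cdots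 \overline{B}_{k_2}(\overline{B}_{k_1}f)))-f\|_\infty\le\sum_{p=1}^r\|\overline{B}_{k_p}f-f\|_\infty\le\sum_{p=1}^r\left[\omega\left(f,\frac1{k_p}+\frac1{k_p^\alpha}\right)+\frac{2\left(q+\frac1q\right)\|f\|_\infty}{e^{\beta(k_p^{1-\alpha}-1)}}\right]\le r\left[\omega\left(f,\frac1{k_1}+\frac1{k_1^\alpha}\right)+\frac{2\left(q+\frac1q\right)\|f\|_\infty}{e^{\beta(k_1^{1-\alpha}-1)}}\right].$$
   Context: $\mathbb{N}=\{1,2,\dots\}$. For $q,\beta>0$ and $x\in\mathbb{R}$ let $\nu_{q}(x)=\frac{1-qe^{-\beta x}}{1+qe^{-\beta x}}$ and $G_{q,\beta}(x)=\frac14\left(\nu_{q}(x+1)-\nu_{q}(x-1)\right)$; $G_{1/q,\beta}$ is the same with $q$ replaced by $1/q$. Let $\Psi=\frac12\left(G_{q,\beta}+G_{1/q,\beta}\right)$ (an even probability density on $\mathbb{R}$). $C_B(\mathbb{R})$ is the set of continuous bounded real functions on $\mathbb{R}$, with supremum norm $\|\cdot\|_\infty$. For $\theta>0$, $\omega(f,\theta)=\sup\{|f(x)-f(y)|: x,y\in\mathbb{R},\ |x-y|\le\theta\}$. For $n\in\mathbb{N}$ the operators are $$B_n(f)(x)=\int_{-\infty}^{\infty}f\left(\frac vn\right)\Psi(nx-v)\,dv,$$ $$B_n^*(f)(x)=n\int_{-\infty}^{\infty}\left(\int_0^{1/n}f\left(h+\frac vn\right)dh\right)\Psi(nx-v)\,dv,$$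 $$\overline{B}_n(f)(x)=\int_{-\infty}^{\infty}\left(\sum_{j=1}^M w_j f\left(\frac vn+\frac{j}{nM}\right)\right)\Psi(nx-v)\,dv .$$ They map $C_B(\mathbb{R})$ into itself. *)

(* Defs.v *)
From HB Require Import structures.
From mathcomp Require Export all_boot all_order all_algebra.
From mathcomp Require Export all_classical all_reals all_analysis.
Import Order.TTheory GRing.Theory Num.Theory.
Import numFieldNormedType.Exports.

Local Open Scope classical_set_scope.
Local Open Scope ring_scope.

Definition nu {R : realType} (q beta x : R) : R :=
  (1 - q * expR (- (beta * x))) / (1 + q * expR (- (beta * x))).

Definition G {R : realType} (q beta x : R) : R :=
  4^-1 * (nu q beta (x + 1) - nu q beta (x - 1)).

Definition Psi {R : realType} (q beta x : R) : R :=
  2^-1 * (G q beta x + G q^-1 beta x).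

Definition CB {R : realType} (f : R -> R) : Prop :=
  continuous f /\ bounded_fun f.

(* As a real supremum, supnorm and omega are meaningful only for bounded
   functions: sup is 0 on a set that is not bounded above. *)
Definition supnorm {R : realType} (f : R -> R) : R :=
  sup [set `|f x| | x in [set: R]].

Definition omega {R : realType} (f : R -> R) (theta : R) : R :=
  sup [set `|f z.1 - f z.2| | z in [set z : R * R | `|z.1 - z.2| <= theta]].

Definition Bop {R : realType} (q beta : R) (n : nat) (f : R -> R) (x : R) : R :=
  \int[lebesgue_measure]_(v in [set: R])
    (f (v / n%:R) * Psi q beta (n%:R * x - v)).

Definition Bstar {R : realType} (q beta : R) (n : nat) (f : R -> R) (x : R) : R :=
  n%:R * \int[lebesgue_measure]_(v in [set: R])
    ((\int[lebesgue_measure]_(h in `[0%R, (1 / n%:R : R)]) f (h + v / n%:R))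
     * Psi q beta (n%:R * x - v)).

(* Only the values w 1, ..., w M of the weight sequence are used. *)
Definition Bbar {R : realType} (q beta : R) (M : nat) (w : nat -> R)
    (n : nat) (f : R -> R) (x : R) : R :=
  \int[lebesgue_measure]_(v in [set: R])
    ((\sum_(1 <= j < M.+1) w j * f (v / n%:R + j%:R / (n%:R * M%:R)))
     * Psi q beta (n%:R * x - v)).

(* iter_op L k r f = L (k r) (L (k r.-1) (... (L (k 1) f))); the value k 0 is
   not used. *)
Fixpoint iter_op {R : realType} (L : nat -> (R -> R) -> R -> R) (k : nat -> nat)
    (r : nat) (f : R -> R) : R -> R :=
  if r is p.+1 then L (k p.+1) (iter_op L k p f) else f.

(* Main.v *)
Require Import Defs.
From HB Require Import structures.
From mathcomp Require Import all_boot all_order all_algebra.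
From mathcomp Require Import all_classical all_reals all_analysis.
From mathcomp Require Import measurable_realfun ring lra.
Import Order.TTheory GRing.Theory Num.Theory.
Import numFieldNormedType.Exports.

Local Open Scope classical_set_scope.
Local Open Scope ring_scope.

(* Each of the three operators has the form f |-> (x |-> int S f(v) Psi(nx - v) dv),
   where S f(v) averages f over a subset of [v/n, v/n + delta].  The density Psi
   has an explicit primitive (a difference of logarithms), which gives its total
   mass 1 and the bound (q + 1/q) e^(-beta (T - 1)) on its mass outside [-T, T].
   Splitting the integral at |nx - v| = n^(1 - alpha) bounds the error of one
   operator: inside, the values of f differ by at most omega, outside by at most
   2 ||f||.  As the operators are linear contractions, telescoping bounds the
   error of their composition by the sum of the individual errors. *)

(** * Sign, symmetry and continuity of [nu] and [Psi] *)

Lemma nu_den_gt0 {R : realType} (q beta x : R) :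
  0 < q -> 0 < 1 + q * expR (- (beta * x)).
Proof. by move=> q0; rewrite addr_gt0// mulr_gt0// expR_gt0. Qed.

(** Multiply numerator and denominator on the right by [q * expR (beta * x)]. Reflection thus
    exchanges [q] and [q^-1], which is why [Psi], symmetrised over both, is even. *)
Lemma nuN {R : realType} (q beta x : R) :
  0 < q -> nu q beta (- x) = - nu q^-1 beta x.
Proof.
move=> q0; have q'0 : 0 < q^-1 by rewrite invr_gt0.
have := nu_den_gt0 q beta (- x) q0; have := nu_den_gt0 q^-1 beta x q'0.
rewrite /nu mulrN opprK expRN.
have := expR_gt0 (beta * x); set E := expR _ => E0 d1 d2.
have d3 : 0 < q * E + 1 by rewrite addr_gt0// mulr_gt0.
field; rewrite ?(gt_eqF E0) ?(gt_eqF q0) ?(gt_eqF d3) ?(gt_eqF d2) //=.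
Qed.

Lemma nu_le {R : realType} (q beta x y : R) :
  0 < q -> 0 < beta -> x <= y -> nu q beta x <= nu q beta y.
Proof.
move=> q0 b0 xy; rewrite /nu ler_pdivrMr ?nu_den_gt0// mulrAC.
rewrite ler_pdivlMr ?nu_den_gt0//.
have : expR (- (beta * y)) <= expR (- (beta * x)).
  by rewrite ler_expR lerN2 ler_pM2l.
move=> /(ler_wpM2l (ltW q0)); nra.
Qed.

Lemma continuous_nu {R : realType} (q beta : R) :
  0 < q -> continuous (nu q beta).
Proof.
move=> q0 x; have ce : expR (- (beta * y)) @[y --> x] --> expR (- (beta * x)).
  apply: continuous_comp; last exact: continuous_expR.
  by apply: cvgN; apply: cvgM; [exact: cvg_cst|exact: cvg_id].
apply: cvgM; first by apply: cvgB; [exact: cvg_cst|apply: cvgM => //; exact: cvg_cst].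
apply: cvgV; first by rewrite gt_eqF ?nu_den_gt0.
by apply: cvgD; [exact: cvg_cst|apply: cvgM => //; exact: cvg_cst].
Qed.

Lemma Psi_ge0 {R : realType} (q beta x : R) :
  0 < q -> 0 < beta -> 0 <= Psi q beta x.
Proof.
move=> q0 b0; have q'0 : 0 < q^-1 by rewrite invr_gt0.
have x1 : x - 1 <= x + 1 by lra.
by rewrite /Psi /G mulr_ge0// addr_ge0// mulr_ge0// subr_ge0 nu_le.
Qed.

Lemma PsiN {R : realType} (q beta x : R) :
  0 < q -> Psi q beta (- x) = Psi q beta x.
Proof.
move=> q0; have q'0 : 0 < q^-1 by rewrite invr_gt0.
rewrite /Psi /G (_ : - x + 1 = - (x - 1)); last by ring.
rewrite (_ : - x - 1 = - (x + 1)); last by ring.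
by rewrite !nuN// invrK; ring.
Qed.

Lemma continuous_Psi {R : realType} (q beta : R) :
  0 < q -> continuous (Psi q beta).
Proof.
move=> q0; have q'0 : 0 < q^-1 by rewrite invr_gt0.
have cG p : 0 < p -> continuous (G p beta).
  move=> p0 x; have cn a : nu p beta (y + a) @[y --> x] --> nu p beta (x + a).
    apply: (@continuous_comp _ _ _ (fun y => y + a) (nu p beta)).
      by apply: cvgD; [exact: cvg_id|exact: cvg_cst].
    exact: continuous_nu.
  by apply: cvgM; [exact: cvg_cst|apply: cvgB; exact: cn].
by move=> x; apply: cvgM; [exact: cvg_cst|apply: cvgD; exact: cG].
Qed.

(** * A closed primitive of [Psi] and its exponential decay *)

Definition softplus {R : realType} (q beta x : R) : R :=
  ln (1 + q * expR (- (beta * x))).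

(** With [u = q * expR (- (beta * x))], both sides equal [- beta * u / (1 + u)], because
    [nu q beta x - 1 = - 2 * u / (1 + u)]. *)
Lemma is_derive_softplus {R : realType} (q beta x : R) : 0 < q ->
  is_derive x 1 (softplus q beta) (2^-1 * beta * (nu q beta x - 1)).
Proof.
move=> q0; have d0 := nu_den_gt0 q beta x q0.
have Dl : is_derive x 1 (fun y : R => - (beta * y)) (- beta).
  by apply: is_derive_eq; rewrite /GRing.scale/= mulr1.
have Dexp : is_derive x 1 (fun y => expR (- (beta * y)))
    (expR (- (beta * x)) * - beta).
  exact: (@is_derive1_comp _ expR (fun y => - (beta * y))).
have De : is_derive x 1 (fun y => 1 + q * expR (- (beta * y)))
    (q * (expR (- (beta * x)) * - beta)).
  by apply: is_derive_eq; rewrite /GRing.scale/=; ring.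
apply: is_derive_eq.
  apply: (@is_derive1_comp _ (@ln R) (fun y => 1 + q * expR (- (beta * y)))).
  exact: is_derive1_ln.
by rewrite /nu; field; rewrite gt_eqF.
Qed.

(* The survival function of the density [Psi], in closed form. *)
Definition Psi_tail {R : realType} (q beta x : R) : R :=
  (4 * beta)^-1 * ((softplus q beta (x - 1) - softplus q beta (x + 1))
                   + (softplus q^-1 beta (x - 1) - softplus q^-1 beta (x + 1))).

(** The terms [- 1] cancel between the shifts by [-1] and [1], so each difference of [softplus] has
    derivative [- 2 * beta] times the corresponding [G]; the factor [(4 * beta)^-1] then leaves the
    mean of the two. *)
Lemma is_derive_Psi_tail {R : realType} (q beta x : R) : 0 < q -> 0 < beta ->
  is_derive x 1 (Psi_tail q beta) (- Psi q beta x).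
Proof.
move=> q0 b0; have q'0 : 0 < q^-1 by rewrite invr_gt0.
have D p a : 0 < p -> is_derive x 1 (fun y => softplus p beta (y + a))
    (2^-1 * beta * (nu p beta (x + a) - 1)).
  move=> p0; rewrite -[X in is_derive _ _ _ X]mulr1.
  apply: (@is_derive1_comp _ (softplus p beta) (fun y => y + a)).
    exact: is_derive_softplus.
  by apply: is_derive_eq; rewrite addr0.
have Dq1 := D q 1 q0; have Dq2 := D q (-1) q0.
have Dp1 := D q^-1 1 q'0; have Dp2 := D q^-1 (-1) q'0.
apply: is_derive_eq.
rewrite /= /GRing.scale/= /Psi /G; field.
by rewrite gt_eqF.
Qed.

Lemma cvg_softplus {R : realType} (q beta a : R) : 0 < q -> 0 < beta ->
  softplus q beta (x + a) @[x --> +oo] --> 0.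
Proof.
move=> q0 b0; rewrite -(@ln1 R) -[in X in _ --> X](addr0 1) -[in X in _ --> X](mulr0 q).
apply: (@continuous_cvg _ _ _ _ _ _ (@ln R)).
  by apply: continuous_ln; rewrite mulr0 addr0.
apply: cvgD; first exact: cvg_cst.
apply: cvgM; first exact: cvg_cst.
apply: (cvg_comp _ _ _ (@cvgr_expR R)).
apply: gt0_cvgMry => //; exact: cvg_addrr.
Qed.

Lemma cvg_Psi_tail {R : realType} (q beta : R) : 0 < q -> 0 < beta ->
  Psi_tail q beta x @[x --> +oo] --> 0.
Proof.
move=> q0 b0; have q'0 : 0 < q^-1 by rewrite invr_gt0.
rewrite (_ : 0 = (4 * beta)^-1 * ((0 - 0) + (0 - 0))); last by rewrite !subr0 addr0 mulr0.
apply: cvgM; first exact: cvg_cst.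
by apply: cvgD; apply: cvgB; exact: cvg_softplus.
Qed.

(** This value normalises [Psi]. Factoring [q * expR beta] out of [1 + q * expR beta] relates the
    values of [softplus] at [-1] and [1]; the terms [ln q] and [ln q^-1] cancel, and [2 * beta] over
    [4 * beta] remains. *)
Lemma Psi_tail0 {R : realType} (q beta : R) : 0 < q -> 0 < beta ->
  Psi_tail q beta 0 = 2^-1.
Proof.
move=> q0 b0; have q'0 : 0 < q^-1 by rewrite invr_gt0.
have e0 := expR_gt0 beta.
have shift p : 0 < p -> softplus p beta (-1) = ln p + beta + softplus p^-1 beta 1.
  move=> p0; have p'0 : 0 < p^-1 by rewrite invr_gt0.
  have d := nu_den_gt0 p^-1 beta 1 p'0.
  rewrite -{2}(expRK beta) /softplus -!lnM ?posrE ?mulr_gt0 ?expR_gt0//.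
  congr ln; rewrite mulrN opprK mulr1 expRN mulrDr mulr1 mulrACA.
  by rewrite !mulfV ?gt_eqF// mulr1 addrC.
rewrite /Psi_tail !sub0r !add0r !shift// invrK lnV ?posrE//.
by field; rewrite gt_eqF.
Qed.

(** The difference is [ln ((1 + a) / (1 + b))] with [b = a * expR (- (2 * beta))]. It is at most
    [(a - b) / (1 + b)], and [a - b <= 2 * beta * a] by the tangent inequality for the exponential
    at 0. *)
Lemma softplusB_le {R : realType} (q beta x : R) : 0 < q -> 0 < beta ->
  softplus q beta (x - 1) - softplus q beta (x + 1)
    <= 2 * beta * q * expR (- (beta * (x - 1))).
Proof.
move=> q0 b0.
set a := q * expR (- (beta * (x - 1))); set b := q * expR (- (beta * (x + 1))).
have a0 : 0 < a by rewrite mulr_gt0// expR_gt0.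
have b0' : 0 < b by rewrite mulr_gt0// expR_gt0.
have a1 : 0 < 1 + a by lra.
have b1 : 0 < 1 + b by lra.
have ab : a - 2 * beta * a <= b.
  have := expR_ge1Dx (- (2 * beta)); rewrite /b => h.
  rewrite (_ : - (beta * (x + 1)) = - (beta * (x - 1)) + - (2 * beta)); last by ring.
  by rewrite expRD mulrA -/a; move: h => /(ler_wpM2l (ltW a0)); lra.
rewrite /softplus -/a -/b -ln_div ?posrE// -!mulrA -/a.
rewrite (_ : (1 + a) / (1 + b) = 1 + (a - b) / (1 + b)); last first.
  by field; rewrite gt_eqF.
have c1 : -1 < (a - b) / (1 + b) by rewrite ltr_pdivlMr//; lra.
(* Clearing the denominator [1 + b] creates this nonlinear term, whose sign [lra] cannot find by
   itself. *)
have bab : 0 < beta * a * b by apply: mulr_gt0 => //; exact: mulr_gt0.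
apply: (le_trans (le_ln1Dx c1)); rewrite ler_pdivrMr//; lra.
Qed.

Lemma Psi_tail_le {R : realType} (q beta x : R) : 0 < q -> 0 < beta ->
  2 * Psi_tail q beta x <= (q + 1 / q) / expR (beta * (x - 1)).
Proof.
move=> q0 b0; have q'0 : 0 < q^-1 by rewrite invr_gt0.
have := softplusB_le q beta x q0 b0; have := softplusB_le q^-1 beta x q'0 b0.
rewrite /Psi_tail -expRN div1r; set u := expR _ => h1 h2.
rewrite mulrA (_ : 2 * (4 * beta)^-1 = (2 * beta)^-1); last first.
  by field; rewrite gt_eqF.
by rewrite mulrC ler_pdivrMr ?mulr_gt0//; lra.
Qed.

(** * Mass of [Psi] on half-lines, outside an interval, and in total *)

Lemma continuous_PsiB {R : realType} (q beta x : R) :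
  0 < q -> continuous (fun v => Psi q beta (x - v)).
Proof.
move=> q0 v; apply: (@continuous_comp _ _ _ (fun v => x - v) (Psi q beta)).
  by apply: cvgB; [exact: cvg_cst|exact: cvg_id].
exact: continuous_Psi.
Qed.

Lemma measurable_PsiB {R : realType} (q beta x : R) :
  0 < q -> measurable_fun setT (fun v : R => Psi q beta (x - v)).
Proof. by move=> q0; apply: continuous_measurable_fun; exact: continuous_PsiB. Qed.

(** Evenness turns the integrand into [Psi q beta (v - x)], whose primitive
    [- Psi_tail q beta (v - x)] vanishes at infinity; the fundamental theorem of calculus on a
    half-line concludes. *)
Lemma integral_Psi_right {R : realType} (q beta x T : R) : 0 < q -> 0 < beta ->
  (\int[lebesgue_measure]_(v in `[(x + T)%R, +oo[) (Psi q beta (x - v)%R)%:E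
   = (Psi_tail q beta T)%:E)%E.
Proof.
move=> q0 b0.
have D (v : R) : is_derive v 1 (fun v : R => - Psi_tail q beta (v - x))
    (Psi q beta (x - v)).
  rewrite -opprB PsiN//.
  have h : is_derive v 1 (fun v : R => Psi_tail q beta (v - x))
      (- Psi q beta (v - x) * 1).
    apply: (@is_derive1_comp _ (Psi_tail q beta) (fun v : R => v - x)).
      exact: is_derive_Psi_tail.
    by apply: is_derive_eq; rewrite subr0.
  by apply: is_derive_eq; rewrite mulr1 opprK.
rewrite (@ge0_continuous_FTC2y _ _ (fun v : R => - Psi_tail q beta (v - x)) _ 0).
- by rewrite sub0e -EFinN opprK (addrC x) addrK.
- by move=> v _; exact: Psi_ge0.
- exact/continuous_subspaceT/continuous_PsiB.
- rewrite -oppr0; apply: cvgN.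
  by apply: (cvg_comp _ _ (cvg_addrr (- x))); exact: cvg_Psi_tail.
- by move=> v _; apply: ex_derive.
- apply: cvg_at_right_filter.
  apply: (differentiable_continuous (f := fun v : R => - Psi_tail q beta (v - x))).
  by apply/derivable1_diffP/ex_derive.
- by move=> v _; rewrite derive1E; exact: derive_val.
Qed.

(** The substitution of [- v] for [v] carries this half-line to a right half-line centred at
    [- x]. *)
Lemma integral_Psi_left {R : realType} (q beta x T : R) : 0 < q -> 0 < beta ->
  (\int[lebesgue_measure]_(v in `]-oo, (x - T)%R]) (Psi q beta (x - v)%R)%:E
   = (Psi_tail q beta T)%:E)%E.
Proof.
move=> q0 b0; rewrite (_ : x - T = - (- x + T)); last by rewrite opprD opprK.
rewrite ge0_integration_by_substitutionNy.
- rewrite -(integral_Psi_right _ _ (- x))//; apply: eq_integral => v _ /=.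
  by rewrite -PsiN//; congr (Psi _ _ _)%:E; rewrite opprK; ring.
- exact/continuous_subspaceT/continuous_PsiB.
- by move=> v _; exact: Psi_ge0.
Qed.

Lemma integral_Psi_outside {R : realType} (q beta x T : R) :
  0 < q -> 0 < beta -> 0 <= T ->
  (\int[lebesgue_measure]_(v in ~` [set` `](x - T)%R, (x + T)%R]])
      (Psi q beta (x - v)%R)%:E
   = (2 * Psi_tail q beta T)%R%:E)%E.
Proof.
move=> q0 b0 T0.
have mP (D : set R) : measurable_fun D (EFin \o (fun v => Psi q beta (x - v))).
  by apply/measurable_EFinP; apply: measurable_funTS; exact: measurable_PsiB.
rewrite setCitv/= ge0_integral_setU//=; last 3 first.
- exact: mP.
- by move=> v _; rewrite lee_fin Psi_ge0.
- apply/disj_setPS => v/= []; rewrite !in_itv/= andbT => h1 h2; lra.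
(* The right piece of the complement is open at [x + T]; closing it adds a null set. *)
rewrite integral_Psi_left// integral_itv_obnd_cbnd// integral_Psi_right//.
by rewrite -EFinD mulr_natl mulr2n.
Qed.

(** Take [T = 0]: the excluded interval is empty, and the two tails have mass one half each. *)
Lemma integral_Psi {R : realType} (q beta x : R) : 0 < q -> 0 < beta ->
  (\int[lebesgue_measure]_(v in setT) (Psi q beta (x - v)%R)%:E = 1)%E.
Proof.
move=> q0 b0; have := integral_Psi_outside q beta x 0 q0 b0 (lexx _).
rewrite Psi_tail0// mulfV// => <-; congr (integral _ _ _).
by rewrite subr0 addr0 set_itv_ge ?setC0// bnd_simp ltxx.
Qed.

(* Bounded measurable functions replace C_B(R): by Tonelli they are stable under
   the operators, with no continuity argument needed. *)
Definition bmfun {R : realType} (f : R -> R) : Prop :=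
  measurable_fun setT f /\ exists c, forall x, `|f x| <= c.

Lemma CB_bmfun {R : realType} (f : R -> R) : CB f -> bmfun f.
Proof.
move=> [cf [M [_ bf]]]; split; first exact: continuous_measurable_fun.
by exists (M + 1) => x; apply: bf => //; rewrite ltrDl.
Qed.

Lemma bmfun_cst {R : realType} (a : R) : bmfun (fun _ : R => a).
Proof. by split=> //; exists `|a|. Qed.

Lemma bmfunB {R : realType} (f g : R -> R) :
  bmfun f -> bmfun g -> bmfun (fun x => f x - g x).
Proof.
move=> [mf [c fc]] [mg [d gd]]; split; first exact: measurable_funB.
by exists (c + d) => x; rewrite (le_trans (ler_normB _ _))// lerD.
Qed.

(** * Supremum norm and modulus of continuity of bounded functions *)

Lemma ler_supnorm {R : realType} (f : R -> R) x :
  bmfun f -> `|f x| <= supnorm f.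
Proof.
move=> [_ [c fc]]; apply: ub_le_sup; last by exists x.
by exists c => _ [y _ <-].
Qed.

Lemma supnorm_le {R : realType} (f : R -> R) c :
  (forall x, `|f x| <= c) -> supnorm f <= c.
Proof.
move=> fc; apply: ge_sup; first by exists `|f 0|, 0.
by move=> _ [y _ <-].
Qed.

Lemma supnorm_ge0 {R : realType} (f : R -> R) : bmfun f -> 0 <= supnorm f.
Proof. by move=> bf; apply: le_trans (ler_supnorm f 0 bf). Qed.

Lemma ler_omega {R : realType} (f : R -> R) (theta x y : R) : bmfun f ->
  `|x - y| <= theta -> `|f x - f y| <= omega f theta.
Proof.
move=> [_ [c fc]] xy; apply: ub_le_sup; last by exists (x, y).
by exists (c + c) => _ [z _ <-]; rewrite (le_trans (ler_normB _ _))// lerD.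
Qed.

(** Nonnegativity of [theta] puts the pair [(0, 0)] in the index set, so the supremum is over a
    nonempty set. *)
Lemma omega_le {R : realType} (f : R -> R) (theta c : R) : 0 <= theta ->
  (forall x y, `|x - y| <= theta -> `|f x - f y| <= c) -> omega f theta <= c.
Proof.
move=> t0 fc; apply: ge_sup.
  by exists `|f 0 - f 0|, (0, 0) => //=; rewrite subrr normr0.
by move=> _ [[x y]/= xy <-]; exact: fc.
Qed.

Lemma omega_ge0 {R : realType} (f : R -> R) (theta : R) :
  bmfun f -> 0 <= theta -> 0 <= omega f theta.
Proof.
move=> bf t0; have := ler_omega f theta 0 0 bf.
by rewrite !subrr normr0; exact.
Qed.

(** Tonelli applies to the positive and negative parts of the integrand separately. The extended
    integral is the difference of the two results, and [fine] is measurable. *)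
Lemma measurable_fun_Rintegral {R : realType} (D : set R) (F : R * R -> R) :
  measurable D -> measurable_fun setT F ->
  measurable_fun setT (fun x => \int[lebesgue_measure]_(v in D) F (x, v)).
Proof.
(* Extending [F] by zero outside [D] in the second variable gives an integral over the whole
   line. *)
move=> mD mF; pose FD : R * R -> R := F \_ (snd @^-1` D).
have mFD : measurable_fun setT FD.
  apply/(measurable_restrictT F).
    by rewrite -[X in measurable X]setTI; exact: measurable_snd.
  exact: measurable_funTS.
rewrite (_ : (fun x => _) =
    (fun x => fine (\int[lebesgue_measure]_v (FD (x, v))%:E)%E)); last first.
  by apply/funext => x; rewrite Rintegral_mkcond.
have mE : measurable_fun setT (EFin \o FD) by exact/measurable_EFinP.
apply: (measurableT_comp (fine_measurable measurableT)).
under eq_fun do rewrite integralE.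
apply: emeasurable_funB.
- have := @measurable_fun_fubini_tonelli_F _ _ (measurableTypeR R)
    (measurableTypeR R) R lebesgue_measure _ (measurable_funepos mE) (funepos_ge0 _).
  apply: eq_measurable_fun => x _; apply: eq_integral => v _.
  by rewrite !funeposE.
- have := @measurable_fun_fubini_tonelli_F _ _ (measurableTypeR R)
    (measurableTypeR R) R lebesgue_measure _ (measurable_funeneg mE) (funeneg_ge0 _).
  apply: eq_measurable_fun => x _; apply: eq_integral => v _.
  by rewrite !funenegE.
Qed.

(** * Averages of bounded functions against [Psi] *)

Section Psi_average.
Context {R : realType} (q beta : R) (q0 : 0 < q) (beta0 : 0 < beta).
Local Notation mu := (@lebesgue_measure R).

Lemma integrable_Psi y : mu.-integrable setT (EFin \o (fun v => Psi q beta (y - v))).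
Proof.
apply/integrableP; split.
  by apply/measurable_EFinP; exact: measurable_PsiB.
under eq_integral => v _ do rewrite /= ger0_norm ?Psi_ge0//.
by rewrite integral_Psi// ltry.
Qed.

Lemma integrable_bmfun_Psi g y : bmfun g ->
  mu.-integrable setT (EFin \o (fun v => g v * Psi q beta (y - v))).
Proof.
move=> [mg [c gc]].
have ic : mu.-integrable setT (EFin \o (fun v => c * Psi q beta (y - v))).
  exact: (integrableZl measurableT c (integrable_Psi y)).
apply: le_integrable ic => //.
  by apply/measurable_EFinP; apply: measurable_funM => //; exact: measurable_PsiB.
move=> v _; rewrite lee_fin !normrM ler_wpM2r// (le_trans (gc v))//.
exact: ler_norm.
Qed.

(* The error is at most [c] near [y], and the excess [d] is only paid on the
   part of the mass of [Psi] at distance at least [T] from [y]. *)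
Lemma Psi_average_dist (g : R -> R) (y a c d T : R) :
  measurable_fun setT g -> 0 <= T -> 0 <= d ->
  (forall v, `|g v - a| <= c + d) ->
  (forall v : R, y - T < v <= y + T -> `|g v - a| <= c) ->
  `|\int[mu]_v (g v * Psi q beta (y - v)) - a| <= c + d * (2 * Psi_tail q beta T).
Proof.
move=> mg T0 d0 gcd gc.
pose O : set R := ~` [set` `]y - T, y + T]].
pose P v := Psi q beta (y - v).
have P0 v : 0 <= P v by exact: Psi_ge0.
have mO : measurable O by apply: measurableC.
have iP : mu.-integrable setT (EFin \o P) := integrable_Psi y.
have bh : bmfun (fun v => g v - a).
  by split; [exact: measurable_funB|exists (c + d)].
have bg : bmfun g.
  split=> //; exists (c + d + `|a|) => v; rewrite -(subrK a (g v)).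
  by rewrite (le_trans (ler_normD _ _))// lerD.
have b1 : bmfun (\1_O : R -> R).
  split; first exact: measurable_indic.
  by exists 1 => v; rewrite indicE; case: (_ \in _); rewrite ?normr1 ?normr0.
have ic : mu.-integrable setT (EFin \o (fun v => c * P v)).
  exact: (integrableZl measurableT c iP).
have i1 : mu.-integrable setT (EFin \o (fun v => \1_O v * P v)).
  exact: integrable_bmfun_Psi.
have id1 : mu.-integrable setT (EFin \o (fun v => d * (\1_O v * P v))).
  exact: (integrableZl measurableT d i1).
(* Since [P] has mass 1, the constant [a] can be moved under the integral. *)
have -> : \int[mu]_v (g v * P v) - a = \int[mu]_v ((g v - a) * P v).
  under [RHS]eq_Rintegral do rewrite mulrBl.
  rewrite RintegralB//; [|exact: integrable_bmfun_Psi|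
    exact: (integrable_bmfun_Psi _ y (bmfun_cst a))].
  by rewrite (RintegralZl a measurableT iP) {3}/Rintegral integral_Psi//= mulr1.
apply: (le_trans (le_normr_Rintegral measurableT (integrable_bmfun_Psi _ y bh))).
(* The bound is itself written as an integral against [P], with the indicator of [O] carrying the
   tail mass; a pointwise comparison then suffices. *)
have -> : c + d * (2 * Psi_tail q beta T) =
    \int[mu]_v (c * P v + d * (\1_O v * P v)).
  rewrite RintegralD// (RintegralZl c measurableT iP) (RintegralZl d measurableT i1).
  rewrite {1}/Rintegral integral_Psi//= mulr1.
  congr (_ + _ * _); rewrite -[LHS]/(fine (2 * Psi_tail q beta T)%:E).
  rewrite -(integral_Psi_outside q beta y)// -/(Rintegral _ _ _) Rintegral_mkcond.
  apply: eq_Rintegral => v _; rewrite patchE indicE.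
  by case: (_ \in _); rewrite ?mul1r ?mul0r.
apply: le_Rintegral => //.
- apply: (integrable_norm (integrable_bmfun_Psi _ y bh)).
- exact: (integrableD measurableT ic id1).
- move=> v _; rewrite normrM (ger0_norm (P0 v)) -/(P v).
rewrite [d * _]mulrA -mulrDl ler_wpM2r// indicE; case: (boolP (v \in O)) => vO.
  by rewrite mulr1.
rewrite mulr0 addr0 gc//; move: vO; rewrite notin_setE /O/= => /contrapT.
by rewrite in_itv.
Qed.
End Psi_average.

(* [S f v] is an average of values of [f] on [[v/n, v/n + delta]]; the last clause
   says so through the balls that contain all those values. *)
Definition averaging {R : realType} (n : nat) (delta : R)
    (S : (R -> R) -> R -> R) : Prop :=
  [/\ forall f, bmfun f -> measurable_fun setT (S f),
      forall f g v, bmfun f -> bmfun g ->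
        S (fun x => f x - g x) v = S f v - S g v
    & forall f v a c, bmfun f ->
        (forall y, v / n%:R <= y <= v / n%:R + delta -> `|f y - a| <= c) ->
        `|S f v - a| <= c].

(** The common shape of the three operators: [Bop] and [Bbar] are instances by unfolding, [Bstar] is
    one after its factor [n] is moved under the integral. *)
Definition Psi_op {R : realType} (q beta : R) (n : nat)
    (S : (R -> R) -> R -> R) (f : R -> R) (x : R) : R :=
  \int[lebesgue_measure]_(v in [set: R]) (S f v * Psi q beta (n%:R * x - v)).

(** * Contraction, linearity, stability and error of one operator *)

Section Psi_op.
Context {R : realType} (q beta : R) (q0 : 0 < q) (beta0 : 0 < beta).
Context (n : nat) (n0 : (0 < n)%N) (delta : R) (delta0 : 0 <= delta).
Context (S : (R -> R) -> R -> R) (aS : averaging n delta S).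
Implicit Types f g : R -> R.

Lemma averaging_bmfun f : bmfun f -> bmfun (S f).
Proof.
case: aS => mS _ bS bf; have [_ [c fc]] := bf.
split; first exact: mS.
by exists c => v; rewrite -[S f v]subr0 (bS f v 0 c)// => y _; rewrite subr0.
Qed.

Lemma Psi_op_contract f c x :
  bmfun f -> (forall y, `|f y| <= c) -> `|Psi_op q beta n S f x| <= c.
Proof.
move=> bf fc; have [mS _ bS] := aS.
have Sc v : `|S f v - 0| <= c.
  by apply: (bS f v 0 c) => // y _; rewrite subr0.
rewrite -[X in `|X|]subr0.
(* The bound holds everywhere, so the excess is 0 and the cut-off may be taken to be 0. *)
apply: (@le_trans _ _ (c + 0 * (2 * Psi_tail q beta 0))); last by rewrite mul0r addr0.
apply: Psi_average_dist => //; first exact: mS.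
by move=> v; rewrite addr0.
Qed.

Lemma Psi_opB f g x : bmfun f -> bmfun g ->
  Psi_op q beta n S (fun y => f y - g y) x
  = Psi_op q beta n S f x - Psi_op q beta n S g x.
Proof.
move=> bf bg; have [_ SB _] := aS.
rewrite /Psi_op -RintegralB//; [|exact/integrable_bmfun_Psi/averaging_bmfun..].
by apply: eq_Rintegral => v _; rewrite SB// mulrBl.
Qed.

(** Boundedness is the contraction property; measurability in [x] follows from joint measurability
    of the integrand in [x] and [v]. *)
Lemma Psi_op_bmfun f : bmfun f -> bmfun (Psi_op q beta n S f).
Proof.
move=> bf; have [_ [c fc]] := bf; split; last first.
  by exists c => x; exact: Psi_op_contract.
have [mS _ _] := aS.
apply: (measurable_fun_Rintegral setT
  (fun z => S f z.2 * Psi q beta (n%:R * z.1 - z.2))) => //.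
apply: measurable_funM.
  exact: (measurableT_comp (mS _ bf) measurable_snd).
apply: (measurableT_comp (continuous_measurable_fun (continuous_Psi q beta q0))).
apply: measurable_funB; last exact: measurable_snd.
by apply: measurable_funM => //; exact: measurable_fst.
Qed.

Lemma Psi_op_dist f x alpha : bmfun f ->
  `|Psi_op q beta n S f x - f x|
    <= omega f (delta + 1 / n%:R `^ alpha)
       + 2 * (q + 1 / q) * supnorm f / expR (beta * (n%:R `^ (1 - alpha) - 1)).
Proof.
move=> bf; have [mS _ bS] := aS.
set om := omega _ _; set T := n%:R `^ (1 - alpha).
have nR : 0 < n%:R :> R by rewrite ltr0n.
have na : 0 < n%:R `^ alpha :> R by rewrite powR_gt0.
have om0 : 0 <= om by apply: omega_ge0 => //; rewrite addr_ge0// divr_ge0// ltW.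
have TE : T = n%:R * (1 / n%:R `^ alpha).
  by rewrite /T powRB ?(gt_eqF nR) ?implybT// powRr1// ?ltW// mul1r.
have s0 := supnorm_ge0 f bf.
(* The excess is [2 * supnorm f], the largest possible gap between two values of [f]; it is weighted
   by the tail mass bounded in [Psi_tail_le]. *)
apply: (@le_trans _ _ (om + 2 * supnorm f * (2 * Psi_tail q beta T))); last first.
  have := Psi_tail_le q beta T q0 beta0 => /(ler_wpM2l (mulr_ge0 (ler0n _ 2) s0)) h.
  by rewrite lerD2l (le_trans h)// le_eqVlt; apply/orP; left; apply/eqP; ring.
apply: Psi_average_dist => //; first exact: mS.
- exact: powR_ge0.
- by rewrite mulr_ge0.
- move=> v; apply: bS => // y _; rewrite (le_trans (ler_normB _ _))//.
  have := ler_supnorm f y bf; have := ler_supnorm f x bf; lra.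
move=> v /andP[v1 v2]; apply: bS => // y /andP[y1 y2]; apply: ler_omega => //.
have h1 : x - 1 / n%:R `^ alpha <= v / n%:R by rewrite ler_pdivlMr//; lra.
have h2 : v / n%:R <= x + 1 / n%:R `^ alpha by rewrite ler_pdivrMr//; lra.
by rewrite ler_norml; lra.
Qed.

End Psi_op.

(** * Compositions of linear contractions *)

Lemma iter_op_bmfun {R : realType} (L : nat -> (R -> R) -> R -> R) k r f :
  (forall p g, (1 <= p <= r)%N -> bmfun g -> bmfun (L (k p) g)) ->
  bmfun f -> bmfun (iter_op L k r f).
Proof.
elim: r => // r IH bL bf /=; apply: (bL r.+1); first by rewrite leqnn.
apply: IH => // p g /andP[p1 pr]; apply: bL.
by rewrite p1 leqW.
Qed.

(** With [g] the composition of the first [r] operators applied to [f] and [L'] the next operator,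
    [L' g - f = L' (g - f) + (L' f - f)]. Contraction bounds the first term by [supnorm] of [g - f],
    to which induction applies. *)
Lemma iter_op_dist {R : realType} (L : nat -> (R -> R) -> R -> R) k r f :
  (forall p g, (1 <= p <= r)%N -> bmfun g -> bmfun (L (k p) g)) ->
  (forall p g h x, (1 <= p <= r)%N -> bmfun g -> bmfun h ->
     L (k p) (fun y => g y - h y) x = L (k p) g x - L (k p) h x) ->
  (forall p g c x, (1 <= p <= r)%N -> bmfun g -> (forall y, `|g y| <= c) ->
     `|L (k p) g x| <= c) ->
  bmfun f ->
  supnorm (fun x => iter_op L k r f x - f x)
    <= \sum_(1 <= p < r.+1) supnorm (fun x => L (k p) f x - f x).
Proof.
move=> bL LB Lc bf.
elim: r bL LB Lc => [|r IH] bL LB Lc.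
  by rewrite big_geq// supnorm_le// => x /=; rewrite subrr normr0.
have W p : (1 <= p <= r)%N -> (1 <= p <= r.+1)%N.
  by move=> /andP[-> /leqW].
have r1 : (1 <= r.+1 <= r.+1)%N by rewrite leqnn.
have bI : bmfun (iter_op L k r f).
  by apply: iter_op_bmfun => // p g /W; exact: bL.
have bd : bmfun (fun x => iter_op L k r f x - f x) by exact: bmfunB.
have bl : bmfun (fun x => L (k r.+1) f x - f x) by apply: bmfunB => //; exact: bL.
rewrite big_nat_recr//=; apply: supnorm_le => x.
rewrite -(subrK (L (k r.+1) f x) (L _ _ x)) -LB// -addrA.
rewrite (le_trans (ler_normD _ _))// lerD//; last exact: (ler_supnorm _ x bl).
apply: (@le_trans _ _ (supnorm (fun x => iter_op L k r f x - f x))).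
  by apply: Lc => // y; exact: (ler_supnorm _ y bd).
apply: IH.
- by move=> p g /W; exact: bL.
- by move=> p g h y /W; exact: LB.
- by move=> p g c y /W; exact: Lc.
Qed.

(** * The three averaging schemes *)

Definition cell_mean {R : realType} (n : nat) (f : R -> R) (v : R) : R :=
  n%:R * \int[lebesgue_measure]_(h in `[0%R, (1 / n%:R : R)]) f (h + v / n%:R).

Section averages.
Context {R : realType}.
Implicit Types f : R -> R.

(** Evaluation at [v / n] is an average over a window of width 0. *)
Lemma averaging_eval n :
  averaging n 0 (fun f (v : R) => f (v / n%:R)).
Proof.
split=> [f [mf _]|//|f v a c _ fc]; last by apply: fc; rewrite addr0 lexx.
by apply: (measurableT_comp mf); exact: measurable_funM.
Qed.

Lemma integrable_itv_bmfun f a b s : bmfun f ->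
  (@lebesgue_measure R).-integrable `[a, b] (EFin \o (fun h => f (h + s))).
Proof.
move=> [mf [c fc]]; apply: measurable_bounded_integrable => //.
- by rewrite /= lebesgue_measure_itv/=; case: ifP => // _; rewrite -EFinB ltry.
- by apply: measurable_funTS; apply: (measurableT_comp mf); exact: measurable_funD.
- exists c; split; first by rewrite num_real.
  by move=> M cM h _ /=; rewrite (le_trans (fc _))// ltW.
Qed.

Lemma averaging_cell_mean n : (0 < n)%N ->
  averaging n (1 / n%:R) (@cell_mean R n).
Proof.
move=> n0; have nR : 0 < n%:R :> R by rewrite ltr0n.
have ie f v bf := integrable_itv_bmfun f 0 (1 / n%:R) (v / n%:R) bf.
(* The cell has length [1 / n], so its mean fixes constants; this lets both the centre [a] and the
   radius [c] be written as cell means. *)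
have In c : n%:R * \int[lebesgue_measure]_(h in `[0%R, (1 / n%:R : R)]) c = c.
  rewrite Rintegral_cst//= lebesgue_measure_itv/= lte_fin divr_gt0//.
  by rewrite -EFinB/= subr0; field; rewrite gt_eqF.
split=> [f [mf _]|f g v bf bg|f v a c bf fc]; rewrite /cell_mean.
- apply: measurable_funM => //.
  apply: (measurable_fun_Rintegral `[0, 1 / n%:R]
    (fun z => f (z.2 + z.1 / n%:R))) => //.
  apply: (measurableT_comp mf); apply: measurable_funD; first exact: measurable_snd.
  by apply: measurable_funM => //; exact: measurable_fst.
- by rewrite RintegralB ?mulrBr//; exact: ie.
have bfa : bmfun (fun y => f y - a) by apply: bmfunB => //; exact: bmfun_cst.
have -> : n%:R *
    (\int[lebesgue_measure]_(h in `[0%R, (1 / n%:R : R)]) f (h + v / n%:R)) - a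
  = n%:R * \int[lebesgue_measure]_(h in `[0%R, (1 / n%:R : R)]) (f (h + v / n%:R) - a).
  rewrite RintegralB//; [|exact: ie|exact: (integrable_itv_bmfun _ _ _ 0 (bmfun_cst a))].
  by rewrite mulrBr In.
rewrite normrM (gtr0_norm nR) -[leRHS](In c) ler_pM2l//.
apply: (le_trans (le_normr_Rintegral _ (ie _ v bfa))) => //.
apply: le_Rintegral => //.
- exact: (integrable_norm (ie _ v bfa)).
- exact: (integrable_itv_bmfun _ _ _ 0 (bmfun_cst c)).
- move=> h /=; rewrite in_itv/= => /andP[h0 h1]; apply: fc.
  by apply/andP; split; lra.
Qed.

Lemma averaging_wsum n (M : nat) (w : nat -> R) : (0 < n)%N -> (0 < M)%N ->
  (forall j, (1 <= j <= M)%N -> 0 <= w j) -> \sum_(1 <= j < M.+1) w j = 1 ->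
  averaging n (1 / n%:R) (fun f v =>
    \sum_(1 <= j < M.+1) w j * f (v / n%:R + j%:R / (n%:R * M%:R))).
Proof.
move=> n0 M0 w0 w1; have nR : 0 < n%:R :> R by rewrite ltr0n.
have MR : 0 < M%:R :> R by rewrite ltr0n.
split=> [f [mf _]|f g v bf bg|f v a c bf fc].
- apply: measurable_sum => j; apply: measurable_funM => //.
  apply: (measurableT_comp mf); apply: measurable_funD => //.
  exact: measurable_funM.
- by rewrite -sumrB; apply: eq_bigr => j _; rewrite mulrBr.
(* The weights sum to 1, so [a] and [c] become weighted sums and the terms can be compared one by
   one. *)
have sw x : \sum_(1 <= j < M.+1) w j * x = x by rewrite -mulr_suml w1 mul1r.
rewrite -[X in _ - X](sw a) -[leRHS](sw c) -sumrB.
apply: (le_trans (ler_norm_sum _ _ _)); rewrite big_nat [leRHS]big_nat.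
apply: ler_sum => j /andP[j1 jM].
rewrite -mulrBr normrM ger0_norm ?w0 ?j1// ler_wpM2l ?w0 ?j1//.
apply: fc; apply/andP; split.
  by rewrite lerDl divr_ge0// mulr_ge0.
(* Here [j / (n * M)] is [1 / n] times [j / M], and [j <= M]. *)
rewrite lerD2l invfM mulrCA div1r ler_piMr ?invr_ge0//.
by rewrite ler_pdivrMr// mul1r ler_nat.
Qed.

End averages.

(** The factor [n] stands outside the outer integral in [Bstar] but inside it in [cell_mean], where
    it makes the inner integral a mean; linearity moves it across. *)
Lemma Bstar_Psi_op {R : realType} (q beta : R) n (f : R -> R) x :
  0 < q -> 0 < beta -> (0 < n)%N -> bmfun f ->
  Bstar q beta n f x = Psi_op q beta n (cell_mean n) f x.
Proof.
move=> q0 b0 n0 bf; have nR : n%:R != 0 :> R by rewrite pnatr_eq0 -lt0n.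
have bm : bmfun (cell_mean n f) := averaging_bmfun _ _ _ (averaging_cell_mean n n0) f bf.
have iS := integrable_bmfun_Psi q beta q0 b0 (cell_mean n f) (n%:R * x) bm.
rewrite /Bstar -[RHS](mulVKf nR) /Psi_op -(RintegralZl n%:R^-1 measurableT iS).
by congr (_ * _); apply: eq_Rintegral => v _; rewrite mulrA /cell_mean mulKf.
Qed.

(** * The chain of estimates, uniformly in the averaging scheme *)

Section main.
Context {R : realType} (q beta alpha : R).
Context (q0 : 0 < q) (beta0 : 0 < beta) (alpha0 : 0 < alpha) (alpha1 : alpha < 1).
Context (r : nat) (k : nat -> nat).
Context (k_gt0 : forall p : nat, (1 <= p <= r)%N -> (0 < k p)%N).
Context (k_mono : forall p : nat, (1 <= p < r)%N -> (k p <= k p.+1)%N).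

Lemma leq_k1 p : (1 <= p <= r)%N -> (k 1%N <= k p)%N.
Proof.
elim: p => // -[//|p] IH /andP[_ pr].
by apply: leq_trans (k_mono p.+1 pr); apply: IH; exact: ltnW.
Qed.

(** One statement covers all three chains. A separate [theta] lets the modulus appear without a
    summand 0 when [delta] is 0. The last inequality holds because each summand decreases as [k p]
    grows, and [k 1] is the least index. *)
Lemma iter_Psi_op_estimate (L S : nat -> (R -> R) -> R -> R) (delta theta : nat -> R)
    (f : R -> R) : bmfun f ->
  (forall n, 0 <= delta n) ->
  (forall m n, (0 < m <= n)%N -> delta n <= delta m) ->
  (forall n, theta n = delta n + 1 / n%:R `^ alpha) ->
  (forall n, (0 < n)%N -> averaging n (delta n) (S n)) ->
  (forall n g x, (0 < n)%N -> bmfun g -> L n g x = Psi_op q beta n (S n) g x) ->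
  [/\ supnorm (fun x => iter_op L k r f x - f x)
        <= \sum_(1 <= p < r.+1) supnorm (fun x => L (k p) f x - f x),
      \sum_(1 <= p < r.+1) supnorm (fun x => L (k p) f x - f x)
        <= \sum_(1 <= p < r.+1)
             (omega f (theta (k p))
              + 2 * (q + 1 / q) * supnorm f
                / expR (beta * ((k p)%:R `^ (1 - alpha) - 1)))
    & \sum_(1 <= p < r.+1)
        (omega f (theta (k p))
         + 2 * (q + 1 / q) * supnorm f
           / expR (beta * ((k p)%:R `^ (1 - alpha) - 1)))
        <= r%:R * (omega f (theta (k 1%N))
                   + 2 * (q + 1 / q) * supnorm f
                     / expR (beta * ((k 1%N)%:R `^ (1 - alpha) - 1)))].
Proof.
move=> bf delta_ge0 delta_anti thetaE aS LE.
have LE' n g : (0 < n)%N -> bmfun g -> L n g = Psi_op q beta n (S n) g.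
  by move=> n0 bg; apply/funext => x; exact: LE.
split.
- apply: iter_op_dist => // [p g /k_gt0 kp bg|p g h x /k_gt0 kp bg bh|
    p g c x /k_gt0 kp bg gc].
  + by rewrite LE'//; exact: (Psi_op_bmfun q beta q0 beta0 _ _ _ (aS _ kp)).
  + rewrite !LE//; last exact: bmfunB.
    exact: (Psi_opB q beta q0 beta0 _ _ _ (aS _ kp)).
  + by rewrite LE//; exact: (Psi_op_contract q beta q0 beta0 _ _ _ (aS _ kp)).
- apply: ler_sum_nat => p /k_gt0 kp; apply: supnorm_le => x; rewrite LE// thetaE.
  exact: (Psi_op_dist q beta q0 beta0 _ kp _ (delta_ge0 _) _ (aS _ kp)).
set E := (X in _ <= r%:R * X).
have -> : r%:R * E = \sum_(1 <= p < r.+1) E by rewrite sumr_const_nat subn1 mulr_natl.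
apply: ler_sum_nat => p pr; rewrite /E.
have kp := k_gt0 _ pr; have k1p := leq_k1 _ pr.
have k1 : (0 < k 1%N)%N.
  by apply: k_gt0; case/andP: pr => p1 pr; exact: (leq_trans p1 pr).
(* Used with exponent [alpha] to compare the arguments of [omega], and with [1 - alpha] to compare
   the exponentials. *)
have pR (a : R) : 0 <= a -> (k 1%N)%:R `^ a <= (k p)%:R `^ a.
  by move=> a0; rewrite (ge0_ler_powR a0) ?nnegrE ?ler0n// ler_nat.
have th : theta (k p) <= theta (k 1%N).
  rewrite !thetaE lerD ?delta_anti ?k1//.
  by rewrite !div1r lef_pV2 ?posrE ?powR_gt0 ?ltr0n// pR// ltW.
have th0 : 0 <= theta (k p) by rewrite thetaE addr_ge0// divr_ge0// powR_ge0.
rewrite lerD//.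
  by apply: omega_le => // x y xy; apply: ler_omega => //; exact: le_trans th.
have C0 : 0 <= 2 * (q + 1 / q) * supnorm f.
  by rewrite mulr_ge0 ?supnorm_ge0// mulr_ge0// addr_ge0 ?divr_ge0// ltW.
apply: ler_wpM2l => //.
by rewrite lef_pV2 ?posrE ?expR_gt0// ler_expR ler_pM2l// lerD2r pR// subr_ge0 ltW.
Qed.

End main.
Theorem theorem15 (R : realType) (q beta alpha : R)
  (hq : 0 < q) (hbeta : 0 < beta) (halpha0 : 0 < alpha) (halpha1 : alpha < 1)
  (r : nat) (hr : (0 < r)%N)
  (k : nat -> nat)
  (hk_pos : forall p : nat, (1 <= p <= r)%N -> (0 < k p)%N)
  (hk_mono : forall p : nat, (1 <= p < r)%N -> (k p <= k p.+1)%N)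
  (hk : forall p : nat, (1 <= p <= r)%N -> 2 < (k p)%:R `^ (1 - alpha) :> R)
  (f : R -> R) (hf : CB f)
  (M : nat) (hM : (0 < M)%N) (w : nat -> R)
  (hw : forall j : nat, (1 <= j <= M)%N -> 0 <= w j)
  (hw1 : \sum_(1 <= j < M.+1) w j = 1) :
  [/\ supnorm (fun x => iter_op (Bop q beta) k r f x - f x)
        <= \sum_(1 <= p < r.+1) supnorm (fun x => Bop q beta (k p) f x - f x),
      \sum_(1 <= p < r.+1) supnorm (fun x => Bop q beta (k p) f x - f x)
        <= \sum_(1 <= p < r.+1)
             (omega f (1 / (k p)%:R `^ alpha)
              + 2 * (q + 1 / q) * supnorm f
                / expR (beta * ((k p)%:R `^ (1 - alpha) - 1)))
    & \sum_(1 <= p < r.+1)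
        (omega f (1 / (k p)%:R `^ alpha)
         + 2 * (q + 1 / q) * supnorm f
           / expR (beta * ((k p)%:R `^ (1 - alpha) - 1)))
        <= r%:R * (omega f (1 / (k 1%N)%:R `^ alpha)
                   + 2 * (q + 1 / q) * supnorm f
                     / expR (beta * ((k 1%N)%:R `^ (1 - alpha) - 1)))]
  /\
  [/\ supnorm (fun x => iter_op (Bstar q beta) k r f x - f x)
        <= \sum_(1 <= p < r.+1) supnorm (fun x => Bstar q beta (k p) f x - f x),
      \sum_(1 <= p < r.+1) supnorm (fun x => Bstar q beta (k p) f x - f x)
        <= \sum_(1 <= p < r.+1)
             (omega f (1 / (k p)%:R + 1 / (k p)%:R `^ alpha)
              + 2 * (q + 1 / q) * supnorm f
                / expR (beta * ((k p)%:R `^ (1 - alpha) - 1)))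
    & \sum_(1 <= p < r.+1)
        (omega f (1 / (k p)%:R + 1 / (k p)%:R `^ alpha)
         + 2 * (q + 1 / q) * supnorm f
           / expR (beta * ((k p)%:R `^ (1 - alpha) - 1)))
        <= r%:R * (omega f (1 / (k 1%N)%:R + 1 / (k 1%N)%:R `^ alpha)
                   + 2 * (q + 1 / q) * supnorm f
                     / expR (beta * ((k 1%N)%:R `^ (1 - alpha) - 1)))]
  /\
  [/\ supnorm (fun x => iter_op (Bbar q beta M w) k r f x - f x)
        <= \sum_(1 <= p < r.+1) supnorm (fun x => Bbar q beta M w (k p) f x - f x),
      \sum_(1 <= p < r.+1) supnorm (fun x => Bbar q beta M w (k p) f x - f x)
        <= \sum_(1 <= p < r.+1)
             (omega f (1 / (k p)%:R + 1 / (k p)%:R `^ alpha)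
              + 2 * (q + 1 / q) * supnorm f
                / expR (beta * ((k p)%:R `^ (1 - alpha) - 1)))
    & \sum_(1 <= p < r.+1)
        (omega f (1 / (k p)%:R + 1 / (k p)%:R `^ alpha)
         + 2 * (q + 1 / q) * supnorm f
           / expR (beta * ((k p)%:R `^ (1 - alpha) - 1)))
        <= r%:R * (omega f (1 / (k 1%N)%:R + 1 / (k 1%N)%:R `^ alpha)
                   + 2 * (q + 1 / q) * supnorm f
                     / expR (beta * ((k 1%N)%:R `^ (1 - alpha) - 1)))].
Proof.
have bf := CB_bmfun f hf.
have anti m n : (0 < m <= n)%N -> 1 / n%:R <= 1 / m%:R :> R.
  move=> /andP[m0 mn].
  by rewrite !div1r lef_pV2 ?posrE ?ltr0n ?ler_nat// (leq_trans m0).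
split; [|split].
- apply: (iter_Psi_op_estimate q beta alpha hq hbeta halpha0 halpha1 r k hk_pos hk_mono
    (Bop q beta) (fun n g v => g (v / n%:R)) (fun=> 0)
    (fun n => 1 / n%:R `^ alpha)) => // [n|n _]; first by rewrite add0r.
  exact: averaging_eval.
- apply: (iter_Psi_op_estimate q beta alpha hq hbeta halpha0 halpha1 r k hk_pos hk_mono
    (Bstar q beta) cell_mean
    (fun n => 1 / n%:R) (fun n => 1 / n%:R + 1 / n%:R `^ alpha)) => // n.
    exact: averaging_cell_mean.
  by move=> *; exact: Bstar_Psi_op.
- apply: (iter_Psi_op_estimate q beta alpha hq hbeta halpha0 halpha1 r k hk_pos hk_mono
    (Bbar q beta M w) (fun n g v =>
      \sum_(1 <= j < M.+1) w j * g (v / n%:R + j%:R / (n%:R * M%:R)))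
    (fun n => 1 / n%:R) (fun n => 1 / n%:R + 1 / n%:R `^ alpha)) => // n n0.
  exact: averaging_wsum.
Qed.
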